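(* Let $\mathcal{A}\subseteq E$ be a finite set of Eulerian integers such that $|\mathcal{A}|\ge 2$. Then \[ \omega_E\Big(\prod_{\substack{a,b\in\mathcal{A}\\ a\ne b}}(a+b)\Big) > \frac{\log(|\mathcal{A}|-1)-\log 18}{\log 2}. \]
   Context: Let $\omega=\frac{-1+i\sqrt3}{2}$ and let $E=\{a+b\omega: a,b\in\mathbb{Z}\}\subset\mathbb{C}$ be the ring of Eulerian (i.e. Eisenstein) integers. An Euler prime is a prime element of $E$. For $x\in E$, $\omega_E(x)$ denotes the number of distinct Euler prime divisors of $x$, where two primes are considered distinct if and only if they are not associates in $E$. Since every Euler prime divides $0$, $\omega_E(0)=\infty$, so the inequality holds trivially if the product is $0$. *)

(* Defs.v *)
From HB Require Import structures.
From mathcomp Require Import all_boot all_order all_algebra.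
From mathcomp Require Import finmap.
From mathcomp Require Import ring.
From mathcomp Require Import complex.
From mathcomp Require Import all_classical all_reals all_analysis.

Set Implicit Arguments.
Unset Strict Implicit.
Unset Printing Implicit Defensive.

Import Order.TTheory GRing.Theory Num.Theory.

Local Open Scope ring_scope.
Local Open Scope classical_set_scope.
Local Open Scope complex_scope.

Section RingPrimes.
Variable S : comNzRingType.
Implicit Types x y p : S.

Definition rdvd x y : Prop := exists z, y = z * x.

Definition runit x : Prop := exists y, y * x = 1.

Definition rassociate x y : Prop := exists2 u, runit u & y = u * x.

Definition rprime p : Prop :=
  [/\ p <> 0, ~ runit p & forall x y, rdvd p (x * y) -> rdvd p x \/ rdvd p y].

(* Distinct primes are counted up to associates, i.e. as classes of the      *)
(* association relation; [counting] is [+oo] on infinite sets of classes.    *)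
Definition num_prime_divisors (R : realType) x : \bar R :=
  counting [set rassociate p | p in [set p | rprime p /\ rdvd p x]].

End RingPrimes.

Section Eisenstein.
Variable R : realType.

Definition omega : R[i] := (-1 + 'i%C * (Num.sqrt 3)%:C) / 2.

Definition eisenstein_int : {pred R[i]} :=
  fun x => `[< exists a b : int, x = a%:~R + b%:~R * omega >].

Lemma omega_sqr : omega * omega = - 1 - omega.
Proof.
have i2 : 'i%C * 'i%C = -1 :> R[i] by simpc.
have s3 : (Num.sqrt 3)%:C * (Num.sqrt 3)%:C = 3 :> R[i].
  by rewrite -rmorphM -expr2 sqr_sqrtr ?ler0n // rmorph_nat.
rewrite /omega; move: i2 s3; set j := 'i%C; set s := (Num.sqrt 3)%:C => i2 s3.
have js : (j * s) * (j * s) = - 3 by rewrite mulrACA i2 s3 mulN1r.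
have -> : (-1 + j * s) / 2 * ((-1 + j * s) / 2) =
  (1 - 2 * (j * s) + (j * s) * (j * s)) / 4 by field.
by rewrite js; field.
Qed.

Lemma eisenstein_int_subring : subring_closed eisenstein_int.
Proof.
split=> [|x y /asboolP[a [b ->]] /asboolP[c [d ->]]
         |x y /asboolP[a [b ->]] /asboolP[c [d ->]]]; apply/asboolP.
- by exists 1, 0; rewrite mul0r addr0.
- by exists (a - c), (b - d); rewrite !rmorphB /=; ring.
- exists (a * c - b * d), (a * d + b * c - b * d).
  rewrite !(rmorphB, rmorphD, rmorphM) /=.
  have -> : (a%:~R + b%:~R * omega) * (c%:~R + d%:~R * omega) =
    a%:~R * c%:~R + (a%:~R * d%:~R + b%:~R * c%:~R) * omega
    + b%:~R * d%:~R * (omega * omega) by ring.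
  by rewrite omega_sqr; ring.
Qed.

HB.instance Definition _ :=
  GRing.isSubringClosed.Build R[i] eisenstein_int eisenstein_int_subring.

Record eisenstein := Eisenstein {
  eisenstein_val :> R[i];
  eisenstein_valP : eisenstein_val \in eisenstein_int }.

HB.instance Definition _ := [isSub for eisenstein_val].
HB.instance Definition _ := [Choice of eisenstein by <:].
HB.instance Definition _ := [SubChoice_isSubComNzRing of eisenstein by <:].

Definition omega_E (x : eisenstein) : \bar R := num_prime_divisors R x.

End Eisenstein.

(* Main.v *)
(** If a prime power [p^k] divides [a + b] but not [2a], then [b = -a] and
    [a <> -a] modulo [p^k]; pairs with this property are separated by a
    2-colouring attached to [p].  If [s] primes divide the product and
    [16 * 2^s < |A|], two distinct [a], [b] in [A] share their colours for all
    these primes and the signs of their real and imaginary parts.  By unique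
    factorization [a + b] then divides [2a], hence also [a - b], so that
    [|a + b| <= |a - b|]; equal signs force the opposite strict inequality. *)
Require Import Defs.
From mathcomp Require Import all_boot all_order all_algebra.
From mathcomp Require Import finmap.
From mathcomp Require Import ring lra complex.
From mathcomp Require Import all_classical all_reals all_analysis.

Import Order.TTheory GRing.Theory Num.Theory.

Local Open Scope ring_scope.

(** * Divisibility in a commutative ring *)

Lemma rdvd_refl (S : comNzRingType) (x : S) : rdvd x x.
Proof. by exists 1; rewrite mul1r. Qed.

Lemma rdvd_trans (S : comNzRingType) (y x z : S) :
  rdvd x y -> rdvd y z -> rdvd x z.
Proof. by move=> [u ->] [v ->]; exists (v * u); rewrite mulrA. Qed.

Lemma rdvdD (S : comNzRingType) (d x y : S) :
  rdvd d x -> rdvd d y -> rdvd d (x + y).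
Proof. by move=> [u ->] [v ->]; exists (u + v); rewrite mulrDl. Qed.

Lemma rdvdN (S : comNzRingType) (d x : S) : rdvd d x -> rdvd d (- x).
Proof. by move=> [u ->]; exists (- u); rewrite mulNr. Qed.

Lemma rdvdB (S : comNzRingType) (d x y : S) :
  rdvd d x -> rdvd d y -> rdvd d (x - y).
Proof. by move=> dx dy; apply: rdvdD => //; apply: rdvdN. Qed.

Lemma rdvd_mull (S : comNzRingType) (d x y : S) : rdvd d y -> rdvd d (x * y).
Proof. by move=> [u ->]; exists (x * u); rewrite mulrA. Qed.

Lemma rdvd_mulr (S : comNzRingType) (d x y : S) : rdvd d x -> rdvd d (x * y).
Proof. by rewrite mulrC; exact: rdvd_mull. Qed.

Lemma rdvd_mul (S : comNzRingType) (d e x y : S) :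
  rdvd d x -> rdvd e y -> rdvd (d * e) (x * y).
Proof. by move=> [u ->] [v ->]; exists (u * v); rewrite mulrACA. Qed.

Lemma rdvd_exp (S : comNzRingType) (p x : S) (j k : nat) :
  (j <= k)%N -> rdvd (p ^+ k) x -> rdvd (p ^+ j) x.
Proof.
move=> jk; apply: rdvd_trans; exists (p ^+ (k - j)).
by rewrite -exprD subnK.
Qed.

Lemma rdvd_exp2r (S : comNzRingType) (p q : S) (k : nat) :
  rdvd p q -> rdvd (p ^+ k) (q ^+ k).
Proof. by move=> [u ->]; exists (u ^+ k); rewrite exprMn. Qed.

Lemma rdvd_prod (S : comNzRingType) (I : eqType) (r : seq I) (P : pred I)
    (F : I -> S) (i : I) :
  i \in r -> P i -> rdvd (F i) (\prod_(j <- r | P j) F j).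
Proof.
move=> ir Pi; rewrite (perm_big _ (perm_to_rem ir)) big_cons Pi.
exact/rdvd_mulr/rdvd_refl.
Qed.

(* Modulo the least power of [p] not dividing [2a], the classes of [a] and
   [- a] are distinct; the colour tells which of the two contains a chosen
   representative of their union [C a].  In a general ring there may be no such
   least power, whence the existential quantifiers over exponents. *)
Lemma sum_coloring (S : comNzRingType) (p : S) :
  exists col : S -> bool, forall (a b : S) (k : nat),
    rdvd (p ^+ k) (a + b) -> ~ rdvd (p ^+ k) (2 * a) -> col a != col b.
Proof.
pose C (a : S) : set S := [set x | exists k, ~ rdvd (p ^+ k) (2 * a) /\
  (rdvd (p ^+ k) (x - a) \/ rdvd (p ^+ k) (x + a))]%classic.
pose rep a := xget 0 (C a).
exists (fun a => `[< exists k, ~ rdvd (p ^+ k) (2 * a) /\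
                       rdvd (p ^+ k) (rep a - a) >]) => a b k0 k0ab k0a.
have dbl x y k : rdvd (p ^+ k) (x + y) -> rdvd (p ^+ k) (2 * x) ->
    rdvd (p ^+ k) (2 * y).
  move=> xy xk; have -> : 2 * y = 2 * (x + y) - 2 * x by ring.
  by apply: rdvdB => //; apply: rdvd_mull.
have k0b : ~ rdvd (p ^+ k0) (2 * b).
  by move=> kb; apply: k0a; apply: dbl kb; rewrite addrC.
(* The exponent [minn k k0] is either [k] or [k0], so it keeps the non-divisibility of [2 * x],
   while both congruences hold modulo this smaller power. *)
have CS x y : rdvd (p ^+ k0) (x + y) -> ~ rdvd (p ^+ k0) (2 * x) ->
    (C x `<=` C y)%classic.
  move=> k0xy k0x z [k [kx H]].
  have kxy : rdvd (p ^+ minn k k0) (x + y) by apply: rdvd_exp k0xy; apply: geq_minr.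
  exists (minn k k0); split.
    rewrite addrC in kxy => /(dbl _ _ _ kxy).
    by rewrite /minn; case: ifP.
  case: H => /(rdvd_exp _ _ _ _ _ (geq_minl k k0)) H; [right|left].
    have -> : z + y = (z - x) + (x + y) by ring.
    exact: rdvdD.
  have -> : z - y = (z + x) - (x + y) by ring.
  exact: rdvdB.
have Cab : C a = C b.
  by apply/seteqP; split; apply: CS => //; rewrite addrC.
have repab : rep a = rep b by rewrite /rep Cab.
apply/negP => /eqP cab.
have Ca : C a (rep a).
  apply: xgetPex; exists a, k0; split=> //; left.
  by rewrite subrr; exists 0; rewrite mul0r.
(* If both colours are true, [p ^+ k] for the least [k] of the three exponents divides [2 * a] and
   [2 * b]; but [k] is one of the three, and each of them excludes one of these divisibilities. *)
suff [ca cb] : (exists k, ~ rdvd (p ^+ k) (2 * a) /\ rdvd (p ^+ k) (rep a - a))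
            /\ (exists k, ~ rdvd (p ^+ k) (2 * b) /\ rdvd (p ^+ k) (rep b - b)).
  case: ca cb => k1 [k1a k1r] [k2 [k2b k2r]].
  set k := minn k0 (minn k1 k2).
  have kk0 : (k <= k0)%N by rewrite geq_minl.
  have kk1 : (k <= k1)%N by exact: leq_trans (geq_minr _ _) (geq_minl _ _).
  have kk2 : (k <= k2)%N by exact: leq_trans (geq_minr _ _) (geq_minr _ _).
  have ab := rdvd_exp _ _ _ _ _ kk0 k0ab.
  have ra := rdvd_exp _ _ _ _ _ kk1 k1r.
  have rb := rdvd_exp _ _ _ _ _ kk2 k2r.
  have ka : rdvd (p ^+ k) (2 * a).
    have -> : 2 * a = (a + b) + (rep b - b) - (rep a - a) by rewrite repab; ring.
    by apply: rdvdB => //; apply: rdvdD.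
  have kb := dbl _ _ _ ab ka.
  have : k \in [:: k0; k1; k2].
    by rewrite /k /minn !inE; case: ifP => _; [|case: ifP => _]; rewrite eqxx ?orbT.
  by rewrite !inE => /or3P[] /eqP E; rewrite E in ka kb.
(* The colours are assumed equal, so one true colour is enough: [rep a] is congruent to [a] or to
   [- a], and [- a] is congruent to [b]. *)
suff H : (exists k, ~ rdvd (p ^+ k) (2 * a) /\ rdvd (p ^+ k) (rep a - a))
            \/ (exists k, ~ rdvd (p ^+ k) (2 * b) /\ rdvd (p ^+ k) (rep b - b)).
  by case: H => /asboolP H; split; apply/asboolP; rewrite ?cab // -cab.
case: Ca => k [ka [H|H]]; [left; by exists k|right].
exists (minn k k0); rewrite -repab.
have kab := rdvd_exp _ _ _ _ _ (geq_minr k k0) k0ab.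
split.
  rewrite addrC in kab => /(dbl _ _ _ kab).
  by rewrite /minn; case: ifP.
have -> : rep a - b = (rep a + a) - (a + b) by ring.
by apply: rdvdB => //; apply: rdvd_exp H; apply: geq_minl.
Qed.

(** * The norm of Eisenstein integers *)

Section EisensteinArithmetic.
Variable R : realType.
Implicit Types x y z p q : eisenstein R.

(** The squared modulus, with values in [R] rather than [R[i]]. *)
Definition sqnorm (z : R[i]) : R := complex.Re z ^+ 2 + complex.Im z ^+ 2.

Lemma sqnormM (z w : R[i]) : sqnorm (z * w) = sqnorm z * sqnorm w.
Proof. by case: z w => [a b] [c d]; rewrite /sqnorm /=; ring. Qed.

Lemma sqnorm_eq0 (z : R[i]) : (sqnorm z == 0) = (z == 0).
Proof.
by case: z => a b; rewrite /sqnorm eq_complex /= paddr_eq0 ?sqr_ge0 // !sqrf_eq0.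
Qed.

Lemma omegaE : omega R = Complex (- 2^-1) (Num.sqrt 3 / 2).
Proof.
rewrite /omega.
apply: (mulIf (x := 2)); first by rewrite pnatr_eq0.
rewrite divfK ?pnatr_eq0 //.
apply/eqP; rewrite eq_complex /=; apply/andP; split; apply/eqP; by field.
Qed.

Lemma sqnorm_omegaB (a b : R) :
  sqnorm (a%:C%C + b%:C%C * omega R) = a ^+ 2 - a * b + b ^+ 2.
Proof.
rewrite omegaE /sqnorm /=.
have : Num.sqrt 3 ^+ 2 = 3 :> R by rewrite sqr_sqrtr.
move: (Num.sqrt 3) => s s3.
have -> : a ^+ 2 - a * b + b ^+ 2 = (a - b / 2) ^+ 2 + b ^+ 2 / 4 * 3 by field.
by rewrite -s3; field.
Qed.

Lemma intr_complex (a : int) : a%:~R = (a%:~R : R)%:C%C :> R[i].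
Proof. by rewrite rmorph_int. Qed.

(** The norm form [a ^+ 2 - a * b + b ^+ 2] has integer values. This permits descent on the norm and
    forces a norm below 1 to vanish. *)
Lemma sqnorm_nat x : exists n : nat, sqnorm (eisenstein_val x) = n%:R.
Proof.
case: x => z /= /asboolP[a [b ->]].
have H : sqnorm (a%:~R + b%:~R * omega R) = (a ^+ 2 - a * b + b ^+ 2)%:~R :> R.
  by rewrite !intr_complex sqnorm_omegaB !(rmorphD, rmorphN, rmorphM, rmorphXn).
have : 0 <= (a ^+ 2 - a * b + b ^+ 2)%:~R :> R.
  by rewrite -H addr_ge0 ?sqr_ge0.
rewrite ler0z H; case: (_ + _) => // n _; by exists n.
Qed.


Lemma eisenstein_valM x y :
  eisenstein_val (x * y) = eisenstein_val x * eisenstein_val y.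
Proof. exact: (rmorphM (\val : eisenstein R -> R[i])). Qed.

Lemma eisenstein_valD x y :
  eisenstein_val (x + y) = eisenstein_val x + eisenstein_val y.
Proof. exact: (rmorphD (\val : eisenstein R -> R[i])). Qed.

Lemma eisenstein_valB x y :
  eisenstein_val (x - y) = eisenstein_val x - eisenstein_val y.
Proof. exact: (rmorphB (\val : eisenstein R -> R[i])). Qed.

Lemma eisenstein_neq0 x : x <> 0 -> eisenstein_val x != 0.
Proof.
move=> x0; apply/eqP => H; apply: x0; apply: val_inj.
by rewrite rmorph0.
Qed.

Lemma eisenstein_mulIf x y z : z <> 0 -> x * z = y * z -> x = y.
Proof.
move=> z0 /(congr1 (@eisenstein_val R)).
rewrite !eisenstein_valM => /(mulIf (eisenstein_neq0 _ z0)).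
exact: val_inj.
Qed.

(** * Euclidean division and its consequences *)

Lemma round_half (r : R) : exists n : int, (r - n%:~R) ^+ 2 <= 1 / 4.
Proof.
have := floor_itv (r + 1 / 2); set n := Num.floor _ => /andP[n1 n2].
exists n; move: n1 n2; rewrite intrD; move: (n%:~R : R) => m n1 n2.
by nra.
Qed.

Lemma eisenstein_round (z : R[i]) :
  exists q, sqnorm (z - eisenstein_val q) < 1.
Proof.
case: z => u v; have s3 : Num.sqrt 3 ^+ 2 = 3 :> R by rewrite sqr_sqrtr.
have s0 : Num.sqrt 3 != 0 :> R by rewrite sqrtr_eq0 -ltNge.
(* [2 * v / Num.sqrt 3] is the coordinate of [z] along [omega]. Rounding it first, then the real
   part that remains, leaves an error of at most 3/4 * 1/4 + 1/4 = 7/16. *)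
have [n Hn] := round_half (2 * v / Num.sqrt 3).
have [m Hm] := round_half (u + n%:~R / 2).
have qP : m%:~R + n%:~R * omega R \in @eisenstein_int R by apply/asboolP; exists m, n.
exists (Eisenstein qP); rewrite /= omegaE !intr_complex /sqnorm /=.
move: Hn Hm s0 s3; move: (Num.sqrt 3) (m%:~R : R) (n%:~R : R).
move=> s {qP}m {}n Hn Hm s0 s3.
have -> : v - (0 + (n * (s / 2) + 0 * - 2^-1)) = s / 2 * (2 * v / s - n).
  by field.
have -> : u - (m + (n * - 2^-1 - 0 * (s / 2))) = u + n / 2 - m by field.
rewrite exprMn expr_div_n s3; lra.
Qed.

Lemma eisenstein_euclid x y : y <> 0 -> exists q,
  sqnorm (eisenstein_val (x - q * y)) < sqnorm (eisenstein_val y).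
Proof.
move=> /eisenstein_neq0 y0.
have [q Hq] := eisenstein_round (eisenstein_val x / eisenstein_val y).
exists q.
have -> : eisenstein_val (x - q * y)
    = (eisenstein_val x / eisenstein_val y - eisenstein_val q) * eisenstein_val y.
  by rewrite mulrBl divfK // -eisenstein_valM; exact: eisenstein_valB.
rewrite sqnormM gtr_pMl // lt_neqAle eq_sym sqnorm_eq0 y0.
by rewrite addr_ge0 ?sqr_ge0.
Qed.

Lemma sqnorm_ind (P : eisenstein R -> Prop) :
  (forall x,
     (forall y, sqnorm (eisenstein_val y) < sqnorm (eisenstein_val x) -> P y) ->
     P x) ->
  forall x, P x.
Proof.
move=> IH x; have [n] := sqnorm_nat x.
elim/ltn_ind: n x => n IHn x xn; apply: IH => y; rewrite xn.
by have [k yk] := sqnorm_nat y; rewrite yk ltr_nat => /IHn; apply.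
Qed.

(** Euclid's algorithm: the pair [x], [y] is replaced by [y - q * x], [x]. *)
Lemma eisenstein_bezout x y : exists u v,
  rdvd (u * x + v * y) x /\ rdvd (u * x + v * y) y.
Proof.
elim/sqnorm_ind: x y => x IH y.
have [->|/eqP x0] := eqVneq x 0.
  exists 0, 1; rewrite mulr0 add0r mul1r; split; last exact: rdvd_refl.
  by exists 0; rewrite mul0r.
have [q /IH/(_ x)[u [v [Hr Hx]]]] := eisenstein_euclid y x x0.
exists (v - u * q), u.
have E : (v - u * q) * x + u * y = u * (y - q * x) + v * x by ring.
rewrite E; split=> //.
have {2}-> : y = (y - q * x) + q * x by ring.
by apply: rdvdD => //; apply: rdvd_mull.
Qed.

(** Dividing 1 by [x] leaves a remainder of norm below 1, hence zero. *)
Lemma runit_sqnorm x : x <> 0 -> sqnorm (eisenstein_val x) <= 1 -> runit x.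
Proof.
move=> x0 x1; have [q Hq] := eisenstein_euclid 1 x x0.
exists q; have := lt_le_trans Hq x1.
have [n nE] := sqnorm_nat (1 - q * x).
rewrite nE (ltrn1 _ n); case: n nE => // nE _; move: nE => /eqP.
rewrite sqnorm_eq0 => H0; apply/esym/eqP; rewrite -subr_eq0.
by apply/negPn/negP => /eqP/eisenstein_neq0; rewrite H0.
Qed.

Lemma sqnorm_proper_dvd x y z : x = z * y -> x <> 0 -> ~ runit z ->
  sqnorm (eisenstein_val y) < sqnorm (eisenstein_val x).
Proof.
move=> xE x0 zu.
have z0 : z <> 0 by move=> z0; apply: x0; rewrite xE z0 mul0r.
have y0 : y <> 0 by move=> y0; apply: x0; rewrite xE y0 mulr0.
rewrite xE eisenstein_valM sqnormM ltr_pMl.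
  by rewrite ltNge; apply/negP => /(runit_sqnorm _ z0).
by rewrite lt_neqAle eq_sym sqnorm_eq0 eisenstein_neq0 // addr_ge0 ?sqr_ge0.
Qed.

(** * Prime factorization *)

Lemma exists_prime_divisor x : x <> 0 -> ~ runit x ->
  exists p, rprime p /\ rdvd p x.
Proof.
elim/sqnorm_ind: x => x IH x0 xu.
have [xp|xnp] := pselect (rprime x); first by exists x; split => //; exact: rdvd_refl.
have [a [b [xab xa xb]]] : exists a b, [/\ rdvd x (a * b), ~ rdvd x a & ~ rdvd x b].
  apply: contrapT => H; apply: xnp; split=> // a b ab.
  apply: contrapT => /not_orP[xa xb]; apply: H; by exists a, b.
(* The gcd [g] of [x] and [a] is a proper divisor: if [g] were a unit, [x] would divide [b]; if the
   cofactor [h] were one, [x] would divide [a]. *)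
have [u [v]] := eisenstein_bezout x a.
set g := _ + _ => -[[h xh] ga].
have g0 : g <> 0 by move=> g0; apply: x0; rewrite xh g0 mulr0.
have gu : ~ runit g.
  move=> [w wg]; apply: xb.
  have -> : b = w * u * b * x + w * v * (a * b).
    by rewrite -[LHS]mul1r -wg /g; ring.
  by apply: rdvdD; apply: rdvd_mull => //; exact: rdvd_refl.
have hu : ~ runit h.
  move=> [w wh]; apply: xa; apply: rdvd_trans ga.
  by exists w; rewrite xh mulrA wh mul1r.
have [|p [pp pg]] := IH g _ g0 gu; first exact: sqnorm_proper_dvd xh x0 hu.
by exists p; split=> //; rewrite xh; apply: rdvd_mull.
Qed.

Lemma rprime_exp_cancel p x y (k : nat) : rprime p -> ~ rdvd p y ->
  rdvd (p ^+ k) (x * y) -> rdvd (p ^+ k) x.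
Proof.
move=> [p0 _ pp] py; elim: k x => [|k IH] x.
  by move=> _; exists x; rewrite mulr1.
move=> pk; have [[w xw]|//] : rdvd p x \/ rdvd p y.
  by apply: pp; apply: (rdvd_exp _ _ _ 1) pk.
rewrite xw exprSr; apply: rdvd_mul; last exact: rdvd_refl.
apply: IH; case: pk => z; rewrite xw exprSr => H; exists z.
by apply: (eisenstein_mulIf _ _ _ p0); rewrite -[RHS]mulrA -H; ring.
Qed.

Lemma rdvd_prime_sym p q : rprime p -> rprime q -> rdvd q p -> rdvd p q.
Proof.
move=> [p0 _ pp] [_ qu _] [w pw].
have [[z zE]|//] : rdvd p w \/ rdvd p q by apply: pp; rewrite -pw; exact: rdvd_refl.
case: qu; exists z; apply: (eisenstein_mulIf _ _ _ p0).
by rewrite mul1r [RHS]pw zE; ring.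
Qed.

(** Unique factorization in the form needed here: a prime [p] is stripped from both [x] and [y], and
    the norm of [x] drops. *)
Lemma rdvd_prime_powers x y : x <> 0 ->
  (forall p k, rprime p -> rdvd (p ^+ k) x -> rdvd (p ^+ k) y) -> rdvd x y.
Proof.
elim/sqnorm_ind: x y => x IH y x0 H.
have [[u ux]|xu] := pselect (runit x).
  by exists (y * u); rewrite -mulrA ux mulr1.
have [p [pp [x' xE]]] := exists_prime_divisor x x0 xu.
have [y' yE] : rdvd p y by apply: (H p 1%N) => //; exists x'.
have [p0 pu _] := pp.
rewrite xE yE; apply: rdvd_mul; last exact: rdvd_refl.
apply: IH.
- by apply: (sqnorm_proper_dvd _ _ p) => //; rewrite mulrC.
- by move=> x'0; apply: x0; rewrite xE x'0 mul0r.
move=> q k qp qx'; have [q0 _ _] := qp.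
(* If [q] does not divide [p], the factor [p] cancels from [y]. Otherwise they are associates, and
   the hypothesis at exponent [k.+1] leaves [q ^+ k] after one factor is removed. *)
have [qdp|nqp] := pselect (rdvd q p); last first.
  apply: (rprime_exp_cancel _ _ p) => //; rewrite -yE; apply: H => //.
  by rewrite xE; apply: rdvd_mulr.
have [f qf] := rdvd_prime_sym _ _ pp qp qdp.
have [z zE] : rdvd (q ^+ k.+1) y.
  by apply: H => //; rewrite xE exprSr; apply: rdvd_mul.
exists (z * f); apply: (eisenstein_mulIf _ _ _ p0).
rewrite -yE zE exprSr {2}qf; ring.
Qed.

(** * Signs of coordinates and norms *)

Lemma same_sign_mul (r t : R) : (0 < r) = (0 < t) -> (r < 0) = (t < 0) ->
  0 <= r * t ?= iff (r == 0) && (t == 0).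
Proof.
case: (ltgtP r 0) => [r0|r0|->]; case: (ltgtP t 0) => [t0|t0|->] //= _ _.
- by apply/leifP; rewrite nmulr_rgt0.
- by apply/leifP; rewrite mulr_gt0.
- by apply/leifP; rewrite mulr0.
Qed.

(** The two norms differ by [4 * (a * c + b * d)]. Equal signs make both products nonnegative, and
    their sum vanishes only for [z = w = 0]. *)
Lemma sqnormB_ltD (z w : R[i]) : z != w ->
  (0 < complex.Re z) = (0 < complex.Re w) ->
  (complex.Re z < 0) = (complex.Re w < 0) ->
  (0 < complex.Im z) = (0 < complex.Im w) ->
  (complex.Im z < 0) = (complex.Im w < 0) ->
  sqnorm (z - w) < sqnorm (z + w).
Proof.
case: z w => [a b] [c d] zw /= ac ac' bd bd'.
have [ac0 ace] := same_sign_mul _ _ ac ac'; have [bd0 bde] := same_sign_mul _ _ bd bd'.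
have : a * c + b * d != 0.
  apply: contra zw; rewrite paddr_eq0 // [_ * _ == 0]eq_sym ace.
  rewrite [_ * _ == 0]eq_sym bde.
  by move=> /andP[/andP[/eqP-> /eqP->] /andP[/eqP-> /eqP->]].
rewrite /sqnorm /= => ne.
have : 0 < a * c + b * d by rewrite lt_neqAle eq_sym ne addr_ge0.
nra.
Qed.

End EisensteinArithmetic.

Arguments sqnorm {R} z.

Theorem theorem1 (R : realType) (A : {fset eisenstein R}) (hA : (2 <= #|` A|)%N) :
  (((ln (#|` A|%:R - 1) - ln 18) / ln 2)%:E <
   omega_E (\prod_(a <- A) \prod_(b <- A | a != b) (a + b))%R)%E.
Proof.
rewrite /omega_E /num_prime_divisors; set N := \prod_(a <- A) _.
set X := image _ _; rewrite /counting.
case: asboolP => [finX|_]; last exact: ltry.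
rewrite lte_fin ltNge; apply/negP => leX.
set s := #|` fset_set X| in leX.
(* Colourings belong to primes but [X] consists of classes, so a prime is chosen in each class; the
   default 0 is never taken on [X]. *)
pose rep (c : set (eisenstein R)) :=
  xget 0 [set p | [/\ rprime p, rdvd p N & c = rassociate p]]%classic.
have [col colP] := choice (@sum_coloring (eisenstein R)).
(* [s] colours and four sign bits: [2 ^ s * 16] possible values. *)
pose f (a : A) := ([ffun c : fset_set X => col (rep (val c)) (val a)],
  (0 < complex.Re (eisenstein_val (val a)), complex.Re (eisenstein_val (val a)) < 0,
   0 < complex.Im (eisenstein_val (val a)), complex.Im (eisenstein_val (val a)) < 0)).
(* The negated bound reads [18 * 2 ^ s <= #|A| - 1], which implies this one. *)
have cardA : (16 * 2 ^ s < #|` A|)%N.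
  have ln2 : 0 < ln 2 :> R by rewrite ln_gt0 // ltr1n.
  have A1 : 0 < #|` A|%:R - 1 :> R by rewrite subr_gt0 ltr1n.
  move: leX; rewrite ler_pdivlMr // lerBrDr mulr_natl.
  rewrite -lnXn // -lnM ?posrE ?exprn_gt0 //.
  rewrite ler_ln ?posrE ?mulr_gt0 ?exprn_gt0 // lerBrDr -natrX -natrM.
  rewrite natr1 ler_nat => /(leq_ltn_trans _); apply.
  by rewrite mulnC leq_mul2l orbT.
have /injectivePn[a [b ab fab]] : ~~ injectiveb f.
  apply/negP => /injectiveP /leq_card.
  rewrite !card_prod card_ffun !card_bool -!cardfE -/s leqNgt.
  by rewrite mulnC cardA.
case: fab => colab Re1 Re2 Im1 Im2.
set x := val a + val b.
have ab_lt : sqnorm (eisenstein_val (val a - val b)) < sqnorm (eisenstein_val x).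
  rewrite /x eisenstein_valB eisenstein_valD; apply: sqnormB_ltD => //.
have x0 : x <> 0.
  move=> x0; have : 0 < sqnorm (eisenstein_val x).
    by apply: le_lt_trans ab_lt; rewrite addr_ge0 ?sqr_ge0.
  rewrite lt_neqAle eq_sym sqnorm_eq0 => /andP[/eqP + _]; apply.
  by rewrite x0; exact: (rmorph0 (\val : eisenstein R -> R[i])).
have xN : rdvd x N.
  have b_mem : rdvd x (\prod_(b <- A | val a != b) (val a + b)).
    by apply: rdvd_prod (valP b) _; rewrite (inj_eq val_inj).
  apply: rdvd_trans b_mem _.
  pose F a := \prod_(b <- A | a != b) (a + b).
  exact: (rdvd_prod _ _ _ predT F _ (valP a) isT).
have x2a : rdvd x (2 * val a).
  (* Exponent 0 is treated apart, since only a positive power of [p] dividing [x] shows that [p]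
     divides [N] and so has its class in [X]. *)
  apply: rdvd_prime_powers => // p [|k] pp pk.
    by exists (2 * val a); rewrite expr0 mulr1.
  have pN : rdvd p N.
    by apply: rdvd_trans xN; apply: (rdvd_exp _ _ _ 1) pk.
  have cX : rassociate p \in fset_set X by rewrite in_fset_set // inE; exists p.
  have [_ _] : [/\ rprime (rep (rassociate p)), rdvd (rep (rassociate p)) N
      & rassociate p = rassociate (rep (rassociate p))].
    by apply: (@xgetPex _ 0 [set q | [/\ rprime q, rdvd q N
         & rassociate p = rassociate q]]%classic); exists p.
  move: colab => /ffunP/(_ [` cX]%fset); rewrite !ffunE /=.
  set q := rep _ => colq pq.
  have assoc_refl y : rassociate y y.
    by exists 1; [exists 1; rewrite mulr1|rewrite mul1r].
  have [u _ pqE] : rassociate q p by rewrite -pq; exact: assoc_refl.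
  have [v _ qpE] : rassociate p q by rewrite pq; exact: assoc_refl.
  (* The colouring is that of the chosen associate [q], so powers of [p] are exchanged for powers of
     [q]. *)
  apply: (rdvd_trans _ (q ^+ k.+1)); first by apply: rdvd_exp2r; exists v.
  apply: contrapT => /(colP q (val a) (val b)); rewrite colq eqxx => H.
  suff: false by []. apply: H.
  by apply: rdvd_trans pk; apply: rdvd_exp2r; exists u.
have [w wE] : rdvd x (val a - val b).
  have -> : val a - val b = 2 * val a - x by rewrite /x; ring.
  by apply: rdvdB => //; exact: rdvd_refl.
have w0 : w <> 0.
  move=> w0; move/eqP: ab; apply; apply/val_inj/eqP.
  by rewrite -subr_eq0 wE w0 mul0r.
(* A nonzero quotient has norm at least 1, so [x] has norm at most that of [val a - val b], against
   [ab_lt]. *)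
have : 1 <= sqnorm (eisenstein_val w).
  have := eisenstein_neq0 _ _ w0; rewrite -sqnorm_eq0.
  by have [n ->] := sqnorm_nat _ w; rewrite pnatr_eq0 -lt0n ler1n.
apply/negP; rewrite -ltNge.
move: ab_lt; rewrite wE eisenstein_valM sqnormM gtr_pMl //.
by rewrite lt_neqAle eq_sym sqnorm_eq0 eisenstein_neq0 // addr_ge0 ?sqr_ge0.
Qed.
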